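(* If a set $X$ of real numbers has property ${\sf U}_{fin}(\Gamma,\Gamma)$ and contains no perfect subset, then $X$ is perfectly meager, i.e., for every perfect set $P\subseteq\mathbb{R}$, $X\cap P$ is meager in the relative topology of $P$.
   Context: ''Cover'' means countable open cover. A cover of $X$ is a $\gamma$-cover if it is infinite and each point of $X$ fails to belong to only finitely many members. $X$ has ${\sf U}_{fin}(\Gamma,\Gamma)$ if for every sequence $(\mathcal{U}_n)$ of $\gamma$-covers of $X$ one can choose finite $\mathcal{V}_n\subseteq\mathcal{U}_n$ such that either $\{\bigcup\mathcal{V}_n:n\in\omega\}$ is a $\gamma$-cover of $X$ or $\bigcup\mathcal{V}_n=X$ for some $n$. *)

(* Defs.v *)
From HB Require Import structures.
From mathcomp Require Import all_boot all_order all_algebra.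
From mathcomp Require Import all_classical all_reals all_analysis.
Import Order.TTheory GRing.Theory Num.Theory.
Import numFieldNormedType.Exports.

Set Implicit Arguments.
Unset Strict Implicit.
Unset Printing Implicit Defensive.

Local Open Scope classical_set_scope.

(* Spaces are topological types. A set [A] of reals is regarded as a space
   through the coercion of [A] to [set_type A], which carries the relative
   topology. Covers are sets of subsets of the space (not indexed families). *)

Definition countable_open_cover (T : topologicalType) (U : set (set T)) : Prop :=
  [/\ countable U, (forall A, U A -> open A) & \bigcup_(A in U) A = [set: T]].

Definition gamma_cover (T : topologicalType) (U : set (set T)) : Prop :=
  [/\ countable_open_cover U, infinite_set U &
      forall x : T, finite_set [set A | U A /\ ~ A x]].

Definition Ufin_Gamma_Gamma (T : topologicalType) : Prop :=
  forall U : nat -> set (set T), (forall n, gamma_cover (U n)) ->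
  exists V : nat -> set (set T),
    (forall n, finite_set (V n) /\ V n `<=` U n) /\
    (gamma_cover [set \bigcup_(A in V n) A | n in [set: nat]] \/
     exists n, \bigcup_(A in V n) A = [set: T]).

(* The empty set satisfies [perfect_set], so nonemptiness has to be required. *)
Definition perfect (T : topologicalType) (P : set T) : Prop :=
  P !=set0 /\ perfect_set P.

Definition nowhere_dense (T : topologicalType) (A : set T) : Prop :=
  interior (closure A) = set0.

Definition meager (T : topologicalType) (A : set T) : Prop :=
  exists F : nat -> set T,
    (forall n, nowhere_dense (F n)) /\ A = \bigcup_n F n.

(* [set_val @^-1` X] is [X `&` P] as a subset of the space [P]. *)
Definition perfectly_meager (T : topologicalType) (X : set T) : Prop :=
  forall P : set T, perfect P -> meager (set_val @^-1` X : set (set_type P)).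

(* Main.v *)
Require Import Defs.
From HB Require Import structures.
From mathcomp Require Import all_boot all_order all_algebra.
From mathcomp Require Import all_classical all_reals all_analysis.
Import Order.TTheory GRing.Theory Num.Theory.
Import numFieldNormedType.Exports.

Set Implicit Arguments.
Unset Strict Implicit.

Local Open Scope classical_set_scope.

(** Since [X] contains no perfect set, [P `\` X] is dense in [P]; pick a countable
    [D] in [P `\` X] that is dense in [P]. The property U_fin(Gamma, Gamma) covers
    [X] by countably many closed sets that miss [D]: feed it the covers of [X]
    whose [m]-th member is the set of points at distance more than [1/(m+1)]
    from the first [k] points of [D]. A closed set missing [D] has nowhere dense
    trace on [P]. *)

Lemma finite_set_nat_bounded (T : Type) (V : set T) (f : T -> nat) :
  finite_set V -> exists M, forall x, V x -> f x <= M.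
Proof.
move=> /(finite_image f)/finite_seqP[s fVs].
exists (\max_(i <- s) i) => x Vx; apply: leq_bigmax_seq => //.
have : (f @` V) (f x) by exists x.
by rewrite fVs.
Qed.

Lemma finite_subset_chain (T : Type) (U : nat -> set T) (V : set (set T)) :
  (forall m n, m <= n -> U m `<=` U n) -> finite_set V -> V `<=` range U ->
  exists M, \bigcup_(A in V) A `<=` U M.
Proof.
move=> Umono finV VU.
have /choice[f fP] A : exists m, V A -> U m = A.
  have [VA|nVA] := pselect (V A); last by exists 0.
  by have [m _ <-] := VU _ VA; exists m.
have [M leM] := @finite_set_nat_bounded _ V f finV.
exists M => x [A VA Ax]; apply: (Umono _ _ (leM _ VA)).
by rewrite fP.
Qed.

(** If the range were finite, its union would lie in a single [U M], which would then be the whole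
    space. A point of [U M] can be missed only by members of index below [M]. *)
Lemma gamma_cover_chain (T : topologicalType) (U : nat -> set T) :
  (forall m, open (U m)) -> (forall m n, m <= n -> U m `<=` U n) ->
  (forall x, exists m, U m x) -> (forall m, U m != setT) ->
  gamma_cover (range U).
Proof.
move=> Uopen Umono Ucov UT; split.
- split.
  + exact: card_image_le.
  + by move=> _ [m _ <-].
  + apply/seteqP; split=> // x _; have [m Umx] := Ucov x.
    by exists (U m) => //; exists m.
- move=> finU; have [M UM] := finite_subset_chain Umono finU (@subset_refl _ _).
  case/eqP: (UT M); apply/seteqP; split=> // x _; apply: UM.
  by have [m Umx] := Ucov x; exists (U m) => //; exists m.
- move=> x; have [M UMx] := Ucov x.
  apply: (@sub_finite_set _ _ (U @` `I_M)); last exact/finite_image/finite_II.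
  move=> _ [[m _ <-] nUmx]; exists m => //=.
  by rewrite ltnNge; apply/negP => /Umono/(_ _ UMx).
Qed.

(** Along an increasing chain a finite selection has its union inside one member, so never equal to
    the whole space; this rules out the second alternative of [Ufin_Gamma_Gamma]. *)
Lemma Ufin_chain (T : topologicalType) (U : nat -> nat -> set T) :
  Ufin_Gamma_Gamma T ->
  (forall k m, open (U k m)) -> (forall k m n, m <= n -> U k m `<=` U k n) ->
  (forall k x, exists m, U k m x) -> (forall k m, U k m != setT) ->
  exists W : nat -> set T,
    gamma_cover (range W) /\ forall k, exists m, W k `<=` U k m.
Proof.
move=> hT Uopen Umono Ucov UT.
have [|V [Vfin VW]] := hT (fun k => range (U k)).
  by move=> k; apply: gamma_cover_chain (Uopen k) (Umono k) (Ucov k) (UT k).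
have Vsub k : exists m, \bigcup_(A in V k) A `<=` U k m.
  by have [finV subV] := Vfin k; exact: finite_subset_chain (Umono k) finV subV.
exists (fun k => \bigcup_(A in V k) A); split=> //.
case: VW => // -[k VkT]; have [m] := Vsub k.
by rewrite VkT subTset => /eqP; rewrite (negbTE (UT k m)).
Qed.

(* Distinct [k] may give the same [W k] in [Ufin_chain], and a point may miss such
   a member for infinitely many [k]; the conclusion therefore only provides
   arbitrarily large [k] for each [F n], and not all large [k]. *)
Lemma Ufin_chain_covering (T : topologicalType) (U : nat -> nat -> set T) :
  Ufin_Gamma_Gamma T ->
  (forall k m, open (U k m)) -> (forall k m n, m <= n -> U k m `<=` U k n) ->
  (forall k x, exists m, U k m x) -> (forall k m, U k m != setT) ->
  exists F : nat -> set T, (forall x, exists n, F n x) /\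
    forall n i, exists k m, i <= k /\ F n `<=` U k m.
Proof.
move=> hT Uopen Umono Ucov UT.
have [W [[_ infW finW] WU]] := Ufin_chain hT Uopen Umono Ucov UT.
(* [F n] collects the points lying in every [W k] that does not repeat one of the first [n] sets. *)
exists (fun n => [set x | forall k, (W @` `I_n) (W k) \/ W k x]); split.
  move=> x.
  have /choice[f fP] A : exists k, range W A -> W k = A.
    have [[k _ <-]|nWA] := pselect (range W A); last by exists 0.
    by exists k.
  have [M leM] := @finite_set_nat_bounded _ _ f (finW x).
  exists M.+1 => k; have [|nWkx] := pselect (W k x); [by right|left].
  by exists (f (W k)); [rewrite /= ltnS; apply: leM|apply: fP; exists k].
move=> n i.
(* As [W] takes infinitely many values, some [W k] differs from all those of index below [maxn n i];
   this forces [i <= k] and puts [F n] inside [W k]. *)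
have : infinite_set (range W `\` W @` `I_(maxn n i)).
  by apply: infinite_setD => //; exact/finite_image/finite_II.
move=> /infinite_setN0[_ [[k _ <-] Wk]].
have [m Wkm] := WU k; exists k, m; split.
  rewrite leqNgt; apply/negP => lt_ki; apply: Wk; exists k => //=.
  by rewrite leq_max lt_ki orbT.
move=> x /(_ k)[[j jn WjWk]|/Wkm//]; case: Wk; exists j => //=.
by rewrite leq_max jn.
Qed.

Lemma closed_covering_avoiding (R : realType) (X : set R) (d : nat -> R) :
  Ufin_Gamma_Gamma (set_type X) -> (forall i, ~ X (d i)) ->
  exists F : nat -> set R,
    [/\ forall n, closed (F n), X `<=` \bigcup_n F n & forall n i, ~ F n (d i)].
Proof.
move=> hX Xd; have [cX|ncX] := pselect (closed X).
  by exists (fun=> X); split=> // x Xx; exists 0.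
have [x0 [cx0 nx0]] : exists x, closure X x /\ ~ X x.
  apply: contrapT => nex; apply: ncX => x cx; apply: contrapT => nx.
  by apply: nex; exists x.
(* A limit point of [X] outside [X] in front of the sequence keeps every [U k m]
   below different from [X], so that the covers are infinite. *)
pose e i := if i is j.+1 then d j else x0.
have Xe i : ~ X (e i) by case: i => [|i] //; exact: Xd.
have dist_cont i : continuous (fun x : R => `|x - e i|)%R.
  by move=> x; apply: cvg_norm; apply: cvgB; [exact: cvg_id|exact: cvg_cst].
have sdist_cont i : continuous (fun x : X => `|set_val x - e i|)%R.
  move=> x; apply: (@continuous_comp _ _ _ set_val (fun x => `|x - e i|)%R).
    exact: initial_continuous.
  exact: dist_cont.
(* Closed balls around [e 0], ..., [e k] are removed; there are finitely many, so [U k m] is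
   open. *)
pose U k m : set X :=
  ~` \bigcup_(i in `I_k.+1) [set x : X | `|set_val x - e i| <= m.+1%:R^-1]%R.
have inUP k m x : U k m x <-> forall i, i <= k -> (m.+1%:R^-1 < `|set_val x - e i|)%R.
  split=> [Ux i ik|Ux [i ik /=]].
    by rewrite real_ltNge ?num_real//; apply/negP => le; apply: Ux; exists i.
  by rewrite leNgt Ux.
have [] := @Ufin_chain_covering X U hX.
- move=> k m; apply: closed_openC; apply: closed_bigcup; first exact: finite_II.
  by move=> i _; exact: (iffLR (continuous_closedP _) (sdist_cont i) _ (@closed_le R _)).
- move=> k m n mn x /inUP Ux; apply/inUP => i /Ux; apply: le_lt_trans.
  by rewrite lef_pV2 ?posrE// ler_nat.
- move=> k x.
  have /choice[f fP] i : exists m, (m.+1%:R^-1 < `|set_val x - e i|)%R.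
    have xe : (0 < `|set_val x - e i|)%R.
      rewrite normr_gt0 subr_eq0; apply/eqP => xe; apply: (Xe i); rewrite -xe.
      exact: set_valP.
    have [m _ /(_ m (leqnn m))] := near_infty_natSinv_lt (PosNum xe).
    by exists m.
  have [M leM] := finite_set_nat_bounded f (finite_II k.+1).
  exists M; apply/inUP => i ik; apply: le_lt_trans (fP i).
  by rewrite lef_pV2 ?posrE// ler_nat ltnS; exact: leM.
- move=> k m; apply/eqP => UT.
  have [y [Xy x0y]] := cx0 _ (nbhsx_ballx x0 m.+1%:R^-1 ltac:(by [])).
  have : U k m (SigSub (mem_set Xy)) by rewrite UT.
  move=> /inUP/(_ 0 isT); rewrite ltNge => /negP; apply.
  by move: x0y; rewrite /ball/= distrC => /ltW.
move=> F [Fcov FU]; exists (fun n => closure (set_val @` F n)); split.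
- by move=> n; exact: closed_closure.
- move=> x Xx; have [n Fx] := Fcov (SigSub (mem_set Xx)); exists n => //.
  by apply: subset_closure; exists (SigSub (mem_set Xx)).
(* Since [d i] is [e i.+1], any [k > i] has it among its centres; [F n] then keeps a fixed distance
   from it, and so does the closure. *)
- move=> n i Fd; have [k [m [ik Fkm]]] := FU n i.+1.
  have : closure [set y : R | m.+1%:R^-1 <= `|y - e i.+1|]%R (d i).
    apply: closureS Fd => _ [y /Fkm/inUP/(_ i.+1 ik)/ltW le_y <-]; exact: le_y.
  rewrite -(iffLR (closure_id _)) /=.
    by rewrite subrr normr0 leNgt invr_gt0 ltr0n.
  exact: (iffLR (continuous_closedP _) (dist_cont i.+1) _ (@closed_ge R _)).
Qed.

(** A neighbourhood of a closure point [x] meets [A] in some [y]; if [y = x], then [x] is itself a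
    limit point of [A], which yields another point. *)
Lemma perfect_set_closure (T : topologicalType) (A : set T) :
  A `<=` limit_point A -> perfect_set (closure A).
Proof.
move=> Alim; split; first exact: closed_closure.
apply/seteqP; split=> [x /subset_limit_point|x clAx U Ux].
  by rewrite -(iffLR (closure_id _) (@closed_closure _ _)).
have [y [Ay Uy]] := clAx U Ux; have [yx|yx] := eqVneq y x.
  have [z [zx Az Uz]] := Alim _ Ay U ltac:(by rewrite yx).
  by exists z; split; rewrite -?yx//; exact: subset_closure.
by exists y; split=> //; exact: subset_closure.
Qed.

(** Otherwise regularity gives a neighbourhood [V] of a point of [P] with closure inside [U], and
    the closure of the part of [P] in the interior of [V] is a perfect subset of [X]. *)
Lemma perfect_open_not_sub (T : topologicalType) (X P U : set T) :
  regular_space T -> ~ (exists Q, perfect Q /\ Q `<=` X) ->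
  perfect_set P -> open U -> P `&` U !=set0 -> P `&` U `\` X !=set0.
Proof.
move=> regT nX [Pcl Plim] Uop [p [Pp Up]]; apply: contrapT => PUX.
have [V pV VU] := regT p U (open_nbhs_nbhs (conj Uop Up)).
apply: nX; exists (closure (P `&` V°)); split.
  split; first by exists p; apply: subset_closure; split.
  apply: perfect_set_closure => x [Px Vx] W Wx.
  have := Px; rewrite -{1}Plim => /(_ (V° `&` W)) [].
    by apply: filterI => //; apply: open_nbhs_nbhs; split=> //; exact: open_interior.
  by move=> y [yx Py [Vy Wy]]; exists y.
move=> x clx; apply: contrapT => nXx; apply: PUX; exists x; split=> //; split.
  by rewrite (iffLR (closure_id _) Pcl); apply: closureS clx; exact: subIsetl.
by apply: VU; apply: closureS clx => y [_ /interior_subset].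
Qed.

(** One point of [P] outside [X] is chosen in each rational interval that meets [P]; a fixed point
    [p0] outside [X] serves the other intervals. *)
Lemma countable_dense_subset_avoiding (R : realType) (X P : set R) :
  ~ P `<=` X ->
  (forall U, open U -> P `&` U !=set0 -> P `&` U `\` X !=set0) ->
  exists d : nat -> R, (forall i, ~ X (d i)) /\
    forall U, open U -> P `&` U !=set0 -> exists i, (P `&` U) (d i).
Proof.
move=> /existsNP[p0 /not_implyP[_ nXp0]] PUX.
pose B (q : rat * rat) : set R := `]ratr q.1, ratr q.2[%classic.
have /choice[f fP] q : exists y, ~ X y /\ (P `&` B q !=set0 -> (P `&` B q) y).
  have [PB|nPB] := pselect (P `&` B q !=set0); last by exists p0.
  have [|y [PBy nXy]] := PUX (B q) _ PB; first exact: interval_open.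
  by exists y.
(* Numbers coding no pair of rationals fall back on the pair [(0, 0)]. *)
exists (fun i => f (odflt (0, 0)%R (unpickle i))); split=> [i|U Uop [p [Pp Up]]].
  by have [] := fP (odflt (0, 0)%R (unpickle i)).
have /nbhs_ballP[e /= e0 eU] := open_nbhs_nbhs (conj Uop Up).
have [q1] := @rat_in_itvoo R (p - e)%R p ltac:(by rewrite ltrBlDr ltrDl).
have [q2] := @rat_in_itvoo R p (p + e)%R ltac:(by rewrite ltrDl).
rewrite !in_itv/= => /andP[pq2 q2e] /andP[eq1 q1p].
exists (pickle (q1, q2)); rewrite pickleK /=.
have [_ []] := fP (q1, q2).
  by exists p; split=> //; rewrite /B/= in_itv/= q1p pq2.
rewrite /B/= in_itv/= => Py /andP[q1y yq2]; split=> //; apply: eU.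
rewrite /ball/= ltr_distlC; apply/andP; split.
  exact: lt_trans eq1 q1y.
exact: lt_trans yq2 q2e.
Qed.

Theorem mainTheorem20 (R : realType) (X : set R)
    (hX : Ufin_Gamma_Gamma (set_type X))
    (hperf : ~ exists P : set R, perfect P /\ P `<=` X) :
  perfectly_meager X.
Proof.
move=> P [P0 perfP].
have [||d [Xd dP]] := @countable_dense_subset_avoiding _ X P.
- by move=> PX; apply: hperf; exists P.
- move=> U; apply: perfect_open_not_sub => //; exact: uniform_regular.
have [F [Fcl XF Fd]] := closed_covering_avoiding hX Xd.
exists (fun n => set_val @^-1` (X `&` F n)); split; last first.
  apply/seteqP; split=> [x /= Xx|x [n _ []//]].
  by have [n _ Fx] := XF _ Xx; exists n.
move=> n; apply/eqP/negPn/negP => /set0P[x].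
(* The closure in [P] stays inside the closed set [F n], so an interior point would give an open [U]
   meeting [P] with its trace in [F n]; but that trace contains some [d i]. *)
have clF : closure (set_val @^-1` (X `&` F n) : set P) `<=` set_val @^-1` F n.
  have /closure_id -> : closed (set_val @^-1` F n : set P).
    exact: (iffLR (continuous_closedP _) (@initial_continuous P R set_val)).
  by apply: closureS => y [].
move=> [_ /= [[U Uop <-] Ux UF]].
have [|i [Pd Ud]] := dP U Uop; first by exists (set_val x); split=> //; exact: set_valP.
by apply: (Fd n i); apply: (clF (SigSub (mem_set Pd))); exact: UF.
Qed.
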